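(* Let $n\ge 2$ and $a\in\mathbb{R}$. Suppose $u\in C^2(\mathbb{R}^n_+)\cap C^0(\overline{\mathbb{R}^n_+})$ satisfies $\operatorname{div}(x_n^a\nabla u)=0$ in $\mathbb{R}^n_+$, $u>-C$ in $\mathbb{R}^n_+$ for some constant $C$, and $u=0$ on $\partial\mathbb{R}^n_+$. Then there is a nonnegative constant $C_*$ such that $u(x)=C_*x_n^{1-a}$ for all $x\in\mathbb{R}^n_+$.
   Context: $\mathbb{R}^n_+=\{x=(x',x_n)\in\mathbb{R}^n: x_n>0\}$ is the open upper half space, $\overline{\mathbb{R}^n_+}=\{x_n\ge 0\}$ and $\partial\mathbb{R}^n_+=\{x_n=0\}$. *)

(* Defs.v *)
From mathcomp Require Import all_boot all_order all_algebra.
From mathcomp Require Import all_classical all_reals all_analysis.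
Set Implicit Arguments.
Unset Strict Implicit.
Unset Printing Implicit Defensive.
Import Order.TTheory GRing.Theory Num.Theory.
Import numFieldNormedType.Exports.
Local Open Scope classical_set_scope.
Local Open Scope ring_scope.

(* The space has dimension n.+1, so that the last coordinate, x_n in the usual
   notation, is x 0 ord_max. *)
Definition last_coord (R : realType) (n : nat) (x : 'rV[R]_n.+1) : R :=
  x 0 ord_max.

Definition half_space (R : realType) (n : nat) : set 'rV[R]_n.+1 :=
  [set x | 0 < last_coord x].

Definition closed_half_space (R : realType) (n : nat) : set 'rV[R]_n.+1 :=
  [set x | 0 <= last_coord x].

Definition half_space_boundary (R : realType) (n : nat) : set 'rV[R]_n.+1 :=
  [set x | last_coord x = 0].

Definition partial (R : realType) (n : nat) (i : 'I_n.+1)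
    (f : 'rV[R]_n.+1 -> R) (x : 'rV[R]_n.+1) : R :=
  'D_(delta_mx 0 i) f x.

Definition grad (R : realType) (n : nat) (f : 'rV[R]_n.+1 -> R)
    (x : 'rV[R]_n.+1) : 'rV[R]_n.+1 :=
  \row_i partial i f x.

Definition divergence (R : realType) (n : nat) (V : 'rV[R]_n.+1 -> 'rV[R]_n.+1)
    (x : 'rV[R]_n.+1) : R :=
  \sum_(i < n.+1) partial i (fun y => V y 0 i) x.

(* f is of class C^k on A: all partial derivatives of f of order at most k exist
   and are continuous on A. Since 'D_v is a limit over a full neighbourhood,
   this is meant for open A. *)
Fixpoint class_C (R : realType) (n : nat) (k : nat) (A : set 'rV[R]_n.+1)
    (f : 'rV[R]_n.+1 -> R) : Prop :=
  {within A, continuous f} /\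
  if k is k'.+1 then
    forall i : 'I_n.+1,
      (forall x, A x -> derivable f x (delta_mx 0 i)) /\
      class_C k' A (partial i f)
  else True.

(* Main.v *)
Require Import Defs.
From mathcomp Require Import all_boot all_order all_algebra.
From mathcomp Require Import all_classical all_reals all_analysis.
From mathcomp Require Import ring lra.
Import Order.TTheory GRing.Theory Num.Theory.
Import numFieldNormedType.Exports.
Local Open Scope classical_set_scope.
Local Open Scope ring_scope.

Set Implicit Arguments.
Unset Strict Implicit.
Unset Printing Implicit Defensive.

(** The proof is by the method of moving spheres, which for a linear equation
    needs no estimate beyond the minimum principle.

    Write N for the dimension, L = Laplacian + (a / x_N) d/dx_N for the operator
    obtained by expanding the divergence, and k = N - 2 + a.  The operator L is
    invariant under inversion in a sphere centred at a boundary point x0: if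
    L U = 0, then the Kelvin transform (|y - x0|^2 / m)^(-k/2) U(y'), where
    y' = x0 + m (y - x0) / |y - x0|^2, also satisfies the equation
    (has_wlap_kelvin).  The two functions agree on the sphere |y - x0|^2 = m.
    Outside it, comparing them by the minimum principle shows that U dominates
    its Kelvin transform.  What is needed at infinity depends on the sign of k.
    If k > 0, the Kelvin transform of the nonnegative function U = u + C tends to
    0 at infinity (kelvin_le_pos).  If k <= 0, that of U = u may grow like
    |y|^(-k), but with an arbitrarily small factor because u vanishes
    continuously at x0, and a barrier which is radial about x0 absorbs it
    together with the lower bound -C (kelvin_le_neg).

    Let y and z be at the same height.  There are spheres centred on the boundary,
    with centres running off to infinity in the direction of z - y, whose
    inversions map y to points of the vertical line through z converging to z,
    while the weights tend to 1.  The limit of the inequalities is U(y) >= U(z)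
    (kelvin_le_horizontal), and by symmetry U depends on the last coordinate only.

    What remains is the equation f'' + (a / t) f' = 0 on t > 0, hence
    f' = c t^(-a).  The condition f(0+) = 0 leaves multiples of t^(1 - a) if a < 1
    and only f = 0 otherwise, and the lower bound fixes the sign (euler_ode). *)

(** * Chain rule along curves for functions with continuous partial derivatives *)

Section CurveDerivatives.
Context {R : realType}.

(** Moves between directional derivatives of a function of several variables and
    one-variable derivatives, where all later computations are made. *)
Lemma is_derive_line (V : normedModType R) (f : V -> R) (x v : V) (t l : R) :
  is_derive (x + t *: v) v f l <-> is_derive t 1 (fun s => f (x + s *: v)) l.
Proof.
have E : (fun h : R => h^-1 *: ((f \o shift (x + t *: v)) (h *: v) -
                           f (x + t *: v))) =
    (fun h : R => h^-1 *: (((fun s => f (x + s *: v)) \o shift t) (h *: 1) -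
                      f (x + t *: v))).
  apply/funext => h /=; congr (_ *: (f _ - _)).
  by rewrite [h *: 1]mulr1 scalerDl addrCA.
by split=> -[]; rewrite /derivable /derive => fd fv; split; move: fd fv;
  rewrite /derivable /derive E.
Qed.

(** These three restate the library rules for pointwise expressions, so that they
    unify with lambda-abstractions and produce values that [ring] and [field]
    can normalize. *)
Lemma is_derive_addf (f g : R -> R) (t p r : R) : is_derive t 1 f p ->
  is_derive t 1 g r -> is_derive t 1 (fun s => f s + g s) (p + r).
Proof. exact: is_deriveD. Qed.

Lemma is_derive_mulf (f g : R -> R) (t p r : R) : is_derive t 1 f p ->
  is_derive t 1 g r -> is_derive t 1 (fun s => f s * g s) (p * g t + f t * r).
Proof.
move=> fd gd; apply: is_derive_eq (is_deriveM fd gd) _.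
by rewrite /GRing.scale /=; ring.
Qed.

Lemma is_derive_invf (f : R -> R) (t p : R) : is_derive t 1 f p -> f t != 0 ->
  is_derive t 1 (fun s => (f s)^-1) (- p / f t ^+ 2).
Proof.
move=> fd f0; apply: is_derive_eq (is_deriveV f0 fd) _.
by rewrite /GRing.scale /=; ring.
Qed.

Lemma continuous_ballP (T : pseudoMetricType R) (f : T -> R) (x : T) :
  {for x, continuous f} <-> forall e : R, 0 < e ->
    exists2 r : R, 0 < r & forall y, ball x r y -> `|f x - f y| <= e.
Proof.
split=> [fc e e0|fe].
  have /nbhs_ballP[r r0 xr] : nbhs x [set y | `|f x - f y| <= e].
    by move: fc => /cvgrPdist_le; apply.
  by exists r.
apply/cvgrPdist_le => e /fe[r r0 xr].
by apply/nbhs_ballP; exists r.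
Qed.

Lemma mvt_either_sign (g dg : R -> R) (h : R) :
  (forall s : R, `|s| <= `|h| -> is_derive s 1 g (dg s)) ->
  exists2 s, `|s| <= `|h| & g h - g 0 = dg s * h.
Proof.
move=> gd.
have gc (s : R) : `|s| <= `|h| -> {for s, continuous g}.
  by move=> /gd sd; apply/differentiable_continuous/derivable1_diffP.
have [h0|h0] := leP 0 h.
  have sI (s : R) : s \in `[0, h] -> `|s| <= `|h|.
    by rewrite in_itv /= => /andP[s0 sh]; rewrite !ger0_norm.
  have [s sm E] : exists2 c, c \in `[0, h] & g h - g 0 = dg c * (h - 0).
    apply: MVT_segment => //.
      by move=> s sm; apply/gd/sI; apply: subset_itv_oo_cc sm.
    apply: continuous_in_subspaceT => s; rewrite inE => sm; exact/gc/sI.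
  by exists s; [exact: sI | rewrite E subr0].
have sI (s : R) : s \in `[h, 0] -> `|s| <= `|h|.
  by rewrite in_itv /= => /andP[s0 sh]; rewrite ler0_norm// ltr0_norm// lerN2.
have [s sm E] : exists2 c, c \in `[h, 0] & g 0 - g h = dg c * (0 - h).
  apply: MVT_segment; first exact: ltW.
    by move=> s sm; apply/gd/sI; apply: subset_itv_oo_cc sm.
  apply: continuous_in_subspaceT => s; rewrite inE => sm; exact/gc/sI.
exists s; first exact: sI.
by rewrite -opprB E sub0r mulrN opprK.
Qed.

(** Caratheodory form of differentiability: the increment of f is split along the
    path that changes the coordinates one at a time, and the mean value theorem
    on each step gives a slope D j tending to the partial derivative.  In this
    form the chain rule reduces to the continuity of sums and products. *)
Lemma C1_slopes n (A : set 'rV[R]_n.+1) (f : 'rV[R]_n.+1 -> R)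
    (d : 'I_n.+1 -> 'rV[R]_n.+1 -> R) (x : 'rV[R]_n.+1) :
  open A -> A x ->
  (forall j y, A y -> is_derive y (delta_mx 0 j) f (d j y)) ->
  (forall j, {for x, continuous (d j)}) ->
  exists D : 'I_n.+1 -> 'rV[R]_n.+1 -> R,
    (forall y, f y - f x = \sum_j D j y * (y 0 j - x 0 j)) /\
    (forall j, {for x, continuous (D j)}) /\ (forall j, D j x = d j x).
Proof.
move=> oA Ax fd dc.
(* The corners of the path from x to y: the first m coordinates are moved. *)
pose P (m : nat) (y : 'rV[R]_n.+1) : 'rV[R]_n.+1 :=
  \row_j (if (j < m)%N then y 0 j else x 0 j).
have PS (j : 'I_n.+1) y :
    P j.+1 y = P j y + (y 0 j - x 0 j) *: delta_mx 0 j.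
  apply/rowP => i; rewrite !mxE ltnS eqxx /= -val_eqE.
  by case: ltngtP => [||/val_inj ->]; rewrite ?mulr0 ?addr0 ?mulr1 // addrC subrK.
exists (fun j (y : 'rV[R]_n.+1) => if y 0 j == x 0 j then d j x
                   else (f (P j.+1 y) - f (P j y)) / (y 0 j - x 0 j)).
split=> [y|].
  have -> : f y - f x = \sum_(0 <= j < n.+1) (f (P j.+1 y) - f (P j y)).
    rewrite telescope_sumr//; congr (f _ - f _); apply/rowP => i; rewrite !mxE //.
    by rewrite ltn_ord.
  rewrite big_mkord; apply: eq_bigr => j _.
  case: eqP => [E|/eqP]; last by rewrite -subr_eq0 => /divfK ->.
  by rewrite PS E subrr scale0r addr0 mulr0 subrr.
split=> j; last by rewrite eqxx.
apply/continuous_ballP => e e0; rewrite eqxx.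
have /continuous_ballP/(_ e e0)[r1 r10 xr1] := dc j.
have /nbhs_ballP[r2 r20 xr2] : nbhs x A by apply: open_nbhs_nbhs.
pose r := Num.min r1 r2.
exists r => [|y yr]; first by rewrite lt_min r10.
have xr z : ball x r z -> A z /\ `|d j x - d j z| <= e.
  move=> xz; split; [apply: xr2|apply: xr1]; apply: (le_ball _ xz);
    by rewrite ge_min lexx ?orbT.
case: eqP => [_|/eqP yx]; first by rewrite subrr normr0 ltW.
pose g s := f (P j y + s *: delta_mx 0 j).
have rr s : `|s| <= `|y 0 j - x 0 j| -> ball x r (P j y + s *: delta_mx 0 j).
  move=> sy; case: (yr) => r0 yr'; split=> // i k; rewrite !ord1 !mxE !eqxx /=.
  rewrite /ball /=.
  have [->|kj] := eqVneq k j.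
    rewrite ltnn mulr1 opprD addNKr normrN (le_lt_trans sy)// distrC.
    exact: (yr' 0 j).
  rewrite mulr0 addr0; case: ifP => _; first exact: (yr' 0 k).
  by rewrite subrr normr0; case: yr.
have [s sy E] : exists2 s, `|s| <= `|y 0 j - x 0 j| &
    g (y 0 j - x 0 j) - g 0 = d j (P j y + s *: delta_mx 0 j) * (y 0 j - x 0 j).
  apply: (mvt_either_sign (dg := fun s => d j (P j y + s *: delta_mx 0 j))).
  move=> s sy; have [As _] := xr _ (rr s sy).
  exact: (proj1 (@is_derive_line _ f (P j y) _ s _) (fd j _ As)).
have -> : f (P j.+1 y) - f (P j y) = g (y 0 j - x 0 j) - g 0.
  by rewrite PS /g scale0r addr0.
rewrite E mulfK ?subr_eq0//.
by have [] := xr _ (rr s sy).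
Qed.

Lemma is_derive_curve n (A : set 'rV[R]_n.+1) (f : 'rV[R]_n.+1 -> R)
    (d : 'I_n.+1 -> 'rV[R]_n.+1 -> R) (c : R -> 'rV[R]_n.+1)
    (c' : 'I_n.+1 -> R) (t : R) :
  open A -> A (c t) ->
  (forall j y, A y -> is_derive y (delta_mx 0 j) f (d j y)) ->
  (forall j, {for c t, continuous (d j)}) ->
  (forall j, is_derive t 1 (fun s => c s 0 j) (c' j)) ->
  is_derive t 1 (fun s => f (c s)) (\sum_j d j (c t) * c' j).
Proof.
move=> oA Act fd dc cd.
have [D [fE [Dc Dx]]] := C1_slopes oA Act fd dc.
have cc : {for t, continuous c}.
  apply/differentiable_continuous/derivable1_diffP/derivable_mxP => i j.
  by rewrite ord1; case: (cd j).
have /choice[g gP] j : exists g, [/\ forall z, c z 0 j - c t 0 j = g z * (z - t),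
        {for t, continuous g} & g t = c' j].
  exact/is_derive1_caratheodory.
apply/is_derive1_caratheodory; exists (fun z => \sum_j D j (c z) * g j z).
split.
- move=> z; rewrite fE mulr_suml; apply: eq_bigr => j _.
  by have [-> _ _] := gP j; rewrite mulrA.
- have Dgc j : {for t, continuous (fun z => D j (c z) * g j z)}.
    apply: continuousM; last by have [] := gP j.
    exact: (continuous_comp cc (Dc j)).
  apply: (@cvg_big _ _ _ _ _ add_continuous) => j _; exact: Dgc.
- by apply: eq_bigr => j _; rewrite Dx; have [_ _ ->] := gP j.
Qed.

End CurveDerivatives.

(** * Second-order jets of functions of one variable *)

Section SecondOrderJets.
Context {R : realType}.
Implicit Types (f g h : R -> R) (t p r : R).

(** A first derivative near t is part of the data: the second derivative at t is
    the derivative of that function, and no limit operator appears. *)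
Definition jet2 h t p r :=
  exists h1 : R -> R, [/\ \forall s \near t, is_derive (s : R) 1 h (h1 s),
    h1 t = p & is_derive t 1 h1 r].

Lemma jet2_ext h t p r p' r' : jet2 h t p r -> p = p' -> r = r' -> jet2 h t p' r'.
Proof. by move=> H <- <-. Qed.

Lemma jet2_continuous h t p r : jet2 h t p r -> {for t, continuous h}.
Proof.
move=> [h1 [/nbhs_singleton hd _ _]].
by apply/differentiable_continuous/derivable1_diffP; case: hd.
Qed.

Lemma jet2_is_derive h t p r : jet2 h t p r -> is_derive t 1 h p.
Proof. by move=> [h1 [/nbhs_singleton hd <- _]]. Qed.

Lemma jet2_cst (a : R) t : jet2 (fun=> a) t 0 0.
Proof.
exists (fun=> 0); split=> //; last exact: is_derive_cst.
by near=> s; exact: is_derive_cst.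
Unshelve. all: by end_near. Qed.

Lemma jet2_affine (a b : R) t : jet2 (fun s => a + s * b) t b 0.
Proof.
exists (fun=> b); split=> //; last exact: is_derive_cst.
near=> s.
apply: is_derive_eq (is_deriveD (is_derive_cst a s 1)
  (is_deriveM (is_derive_id s 1) (is_derive_cst b s 1))) _.
by rewrite scaler0 !add0r [_ *: 1]mulr1.
Unshelve. all: by end_near. Qed.

Lemma jet2D f g t p r p' r' : jet2 f t p r -> jet2 g t p' r' ->
  jet2 (fun s => f s + g s) t (p + p') (r + r').
Proof.
move=> [f1 [fd <- f1d]] [g1 [gd <- g1d]].
exists (fun s => f1 s + g1 s); split=> //; last exact: is_deriveD.
by apply: filterS2 fd gd => s fs gs; exact: is_deriveD.
Qed.

Lemma jet2M f g t p r p' r' : jet2 f t p r -> jet2 g t p' r' ->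
  jet2 (fun s => f s * g s) t (p * g t + f t * p')
    (r * g t + 2 * (p * p') + f t * r').
Proof.
move=> [f1 [fd <- f1d]] [g1 [gd <- g1d]].
exists (fun s => f1 s * g s + f s * g1 s); split=> //.
  apply: filterS2 fd gd => s fs gs.
  exact: is_derive_mulf.
have fd0 := nbhs_singleton fd; have gd0 := nbhs_singleton gd.
apply: is_derive_eq (is_deriveD (is_deriveM f1d gd0) (is_deriveM fd0 g1d)) _.
rewrite /GRing.scale /=; ring.
Qed.

Lemma jet2_comp (F F1 : R -> R) (F2 : R) g t p r :
  jet2 g t p r -> (\forall x \near g t, is_derive (x : R) 1 F (F1 x)) ->
  is_derive (g t) 1 F1 F2 ->
  jet2 (fun s => F (g s)) t (F1 (g t) * p) (F2 * p ^+ 2 + F1 (g t) * r).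
Proof.
move=> gj Fd F1d; have gc := jet2_continuous gj; case: gj => g1 [gd <- g1d].
exists (fun s => F1 (g s) * g1 s); split=> //.
  have Fg : \forall s \near t, is_derive (g s) 1 F (F1 (g s)) by exact: gc _ Fd.
  by apply: filterS2 Fg gd => s Fs gs; exact: is_derive1_comp.
have gd0 := nbhs_singleton gd.
apply: is_derive_eq (is_deriveM (is_derive1_comp F1d gd0) g1d) _.
rewrite /GRing.scale /=; ring.
Qed.

Lemma is_derive_sumf n (h : 'I_n -> R -> R) t (dh : 'I_n -> R) :
  (forall i, is_derive t 1 (h i) (dh i)) ->
  is_derive t 1 (fun s => \sum_i h i s) (\sum_i dh i).
Proof.
move=> hd; rewrite (_ : (fun s => _) = \sum_i h i); first exact: is_derive_sum.
by apply/funext => s; rewrite fct_sumE.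
Qed.

(** If r < 0, then h1 < 0 just to the right of t, and by the mean value theorem h
    takes values below h t there. *)
Lemma jet2_min h t p r : jet2 h t p r -> (\forall s \near t, h t <= h s) ->
  p = 0 /\ 0 <= r.
Proof.
move=> [h1 [hd <- h1d]] hm.
have [e e0 He] : exists2 e : R, 0 < e & forall s, `|s - t| < e ->
    is_derive (s : R) 1 h (h1 s) /\ h t <= h s.
  have /nbhs_ballP[e e0 He] :
      nbhs t [set s | is_derive (s : R) 1 h (h1 s) /\ h t <= h s].
    exact: filterI.
  by exists e => // s st; apply: He; rewrite /ball /= distrC.
have inI s : s \in `](t - e), (t + e)[ -> `|s - t| < e.
  by rewrite in_itv /= ltr_distl.
have h1t : h1 t = 0.
  have d0 : is_derive t 1 h 0.
    apply: (@derive1_at_min _ _ (t - e) (t + e)); first lra.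
    - by move=> s /inI/He[[]].
    - by rewrite in_itv /=; apply/andP; split; lra.
    - by move=> s /inI/He[].
  have [[_ <-] _] := He t ltac:(by rewrite subrr normr0).
  by case: d0.
split=> //; rewrite leNgt; apply/negP => r0.
have /is_derive1_caratheodory[g [gE gc gt]] := h1d.
have /nbhs_ballP[e1 e10 He1] : nbhs t [set s | g s < 0].
  by move/cvgr_lt: gc => /(_ 0); rewrite gt; apply.
pose m := Num.min e e1 / 2.
have m0 : 0 < m by rewrite /m divr_gt0// lt_min e0.
have me : m < e.
  by have : Num.min e e1 <= e; [rewrite ge_min lexx|move: m0; rewrite /m; lra].
have me1 : m < e1.
  by have : Num.min e e1 <= e1;
    [rewrite ge_min lexx orbT|move: m0; rewrite /m; lra].
have near_t s : t <= s <= t + m -> `|s - t| <= m.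
  by move=> /andP[ts sm]; rewrite ger0_norm; lra.
have [s sI E] : exists2 s, s \in `]t, (t + m)[ & h (t + m) - h t = h1 s * (t + m - t).
  apply: MVT; first lra.
    move=> s; rewrite in_itv /= => /andP[/ltW ts /ltW sm].
    by have [] := He s (le_lt_trans (near_t s ltac:(by rewrite ts)) me).
  apply: continuous_in_subspaceT => s; rewrite inE /= in_itv /= => sm.
  apply/differentiable_continuous/derivable1_diffP.
  by have [[]] := He s (le_lt_trans (near_t s sm) me).
move: sI; rewrite in_itv /= => /andP[ts sm].
have h1s : h1 s < 0.
  have gs : g s < 0.
    by apply: He1; rewrite /ball /= distrC (le_lt_trans (near_t s _))// !ltW.
  by have := gE s; rewrite h1t subr0 => ->; rewrite nmulr_rlt0// subr_gt0.
have tm : t + m - t = m by ring.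
have [_ Hm] := He (t + m) ltac:(rewrite tm gtr0_norm//).
have : h1 s * m < 0 by rewrite pmulr_llt0.
by move: E Hm; rewrite tm; lra.
Qed.

(** The derivatives d and dd are explicit arguments because the same d and dd
    serve u and u + c. *)
Definition C2_on n (A : set 'rV[R]_n.+1) (f : 'rV[R]_n.+1 -> R)
    (d : 'I_n.+1 -> 'rV[R]_n.+1 -> R)
    (dd : 'I_n.+1 -> 'I_n.+1 -> 'rV[R]_n.+1 -> R) :=
  forall y, A y ->
  [/\ forall j, is_derive y (delta_mx 0 j) f (d j y),
      forall j, {for y, continuous (d j)},
      forall j l, is_derive y (delta_mx 0 l) (d j) (dd j l y) &
      forall j l, {for y, continuous (dd j l)}].

(** The chain rule is applied twice: to f, at every time near t, and then to each
    of the first derivatives d j at time t. *)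
Lemma jet2_curve n (A : set 'rV[R]_n.+1) (f : 'rV[R]_n.+1 -> R) d dd
    (c : R -> 'rV[R]_n.+1)
    (p r : 'I_n.+1 -> R) t :
  open A -> A (c t) -> C2_on A f d dd ->
  (forall j, jet2 (fun s => c s 0 j) t (p j) (r j)) ->
  jet2 (fun s => f (c s)) t (\sum_j d j (c t) * p j)
    (\sum_j ((\sum_l dd j l (c t) * p l) * p j + d j (c t) * r j)).
Proof.
move=> oA Act fC cj.
have /choice[c1 c1P] : forall j, exists h1 : R -> R,
    [/\ \forall s \near t, is_derive (s : R) 1 (fun s => c s 0 j) (h1 s),
      h1 t = p j & is_derive t 1 h1 (r j)] by [].
have c1d : \forall s \near t, forall j,
    is_derive (s : R) 1 (fun s => c s 0 j) (c1 j s).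
  have H j : nbhs t [set s : R | is_derive s 1 (fun s => c s 0 j) (c1 j s)].
    by case: (c1P j).
  exact: (@filter_forall R _
    (fun j s => is_derive (s : R) 1 (fun s => c s 0 j) (c1 j s)) _ _ H).
have c1d0 := nbhs_singleton c1d.
have cc : {for t, continuous c}.
  apply/differentiable_continuous/derivable1_diffP/derivable_mxP => i j.
  by rewrite ord1; case: (c1d0 j).
have Ac : \forall s \near t, A (c s) by apply: cc; apply: open_nbhs_nbhs.
exists (fun s => \sum_j d j (c s) * c1 j s); split.
- apply: filterS2 c1d Ac => s cs As.
  apply: (is_derive_curve oA As) => // [j y|j]; first by case/fC.
  by case: (fC _ As).
- by apply: eq_bigr => j _; case: (c1P j) => _ ->.
- apply: is_derive_sumf => j; have [_ <- c1j] := c1P j.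
  have D : is_derive t 1 (fun s => d j (c s)) (\sum_l dd j l (c t) * p l).
    have -> : \sum_l dd j l (c t) * p l = \sum_l dd j l (c t) * c1 l t.
      by apply: eq_bigr => l _; case: (c1P l) => _ ->.
    apply: (is_derive_curve oA Act) => // [l y /fC[_ _ + _]|l]; first exact.
    by case: (fC _ Act).
  apply: is_derive_eq (is_deriveM D c1j) _.
  by rewrite /GRing.scale /= addrC [X in X + _]mulrC.
Qed.

End SecondOrderJets.

(** * The weighted Laplacian and the Kelvin transform *)

Section WeightedLaplacian.
Context {R : realType} {n : nat}.
Variable a : R.
Implicit Types (x y z : 'rV[R]_n.+1) (W : 'rV[R]_n.+1 -> R) (i j : 'I_n.+1).

Lemma open_half_space : open (@half_space R n).
Proof.
have -> : @half_space R n = (fun x : 'rV[R]_n.+1 => x 0 ord_max) @^-1` [set t | 0 < t].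
  by [].
apply: open_comp; last exact: open_gt.
by move=> x _; exact: coord_continuous.
Qed.

Definition sqnorm x : R := \sum_j x 0 j ^+ 2.

(** The operator is Laplacian + (a / x_N) d/dx_N, that is, the weighted divergence
    divided by x_N^a.  It is read off the jets of W along the coordinate lines
    through y, so that products and composites are handled by one-variable
    calculus. *)
Definition has_wlap W y (l : R) :=
  exists P Q : 'I_n.+1 -> R,
    (forall i, jet2 (fun t => W (y + t *: delta_mx 0 i)) 0 (P i) (Q i)) /\
    \sum_i Q i + a / last_coord y * P ord_max = l.

Lemma has_wlap_eq W y l l' : has_wlap W y l -> l = l' -> has_wlap W y l'.
Proof. by move=> H <-. Qed.

Lemma has_wlapD W1 W2 y l1 l2 : has_wlap W1 y l1 -> has_wlap W2 y l2 ->
  has_wlap (fun x => W1 x + W2 x) y (l1 + l2).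
Proof.
move=> [P1 [Q1 [J1 <-]]] [P2 [Q2 [J2 <-]]].
exists (fun i => P1 i + P2 i), (fun i => Q1 i + Q2 i); split.
  by move=> i; exact: jet2D.
by rewrite big_split /=; ring.
Qed.

Lemma has_wlapZ (b : R) W y l : has_wlap W y l ->
  has_wlap (fun x => b * W x) y (b * l).
Proof.
move=> [P [Q [J <-]]].
exists (fun i => b * P i), (fun i => b * Q i); split.
  by move=> i; apply: jet2_ext (jet2M (jet2_cst b 0) (J i)) _ _; ring.
by rewrite -mulr_sumr; ring.
Qed.

Lemma has_wlap_min W y l : half_space y -> has_wlap W y l ->
  nbhs y [set x | W y <= W x] -> 0 <= l.
Proof.
move=> hy [P [Q [J <-]]] Wm.
have PQ i : P i = 0 /\ 0 <= Q i.
  apply: jet2_min (J i) _; rewrite scale0r addr0.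
  have lc : {for (0 : R), continuous (fun t : R => y + t *: delta_mx 0 i)}.
    by apply: continuousD; [exact: cst_continuous|exact: scalel_continuous].
  have := lc [set x | W y <= W x]; rewrite /= scale0r addr0; exact.
have [-> _] := PQ ord_max; rewrite mulr0 addr0.
by apply: sumr_ge0 => i _; case: (PQ i).
Qed.

Lemma line_coord y i j (t : R) :
  (y + t *: delta_mx 0 i) 0 j = y 0 j + t * (i == j)%:R.
Proof. by rewrite !mxE eqxx /= eq_sym. Qed.

Lemma sum_delta (f : 'I_n.+1 -> R) j : \sum_i (i == j)%:R * f i = f j.
Proof.
rewrite (bigD1 j)//= eqxx mul1r big1 ?addr0// => i /negPf ->.
by rewrite mul0r.
Qed.

Lemma has_wlap_C2 U d dd y : half_space y -> C2_on (@half_space R n) U d dd ->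
  has_wlap U y (\sum_j dd j j y + a / last_coord y * d ord_max y).
Proof.
move=> hy UC; exists (fun i => d i y), (fun i => dd i i y); split=> // i.
have cj j : jet2 (fun t => (y + t *: delta_mx 0 i) 0 j) 0 (i == j)%:R 0.
  rewrite (_ : (fun t => _) = (fun t => y 0 j + t * (i == j)%:R)).
    exact: jet2_affine.
  by apply/funext => t; rewrite line_coord.
have Hy : half_space (y + (0 : R) *: delta_mx 0 i) by rewrite scale0r addr0.
apply: jet2_ext (jet2_curve open_half_space Hy UC cj) _ _;
  rewrite scale0r addr0.
  by under eq_bigr do rewrite mulrC eq_sym; rewrite sum_delta.
under eq_bigr => j _.
  rewrite mulr0 addr0 mulrC eq_sym.
  under eq_bigr do rewrite mulrC eq_sym.
  rewrite sum_delta; over.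
by rewrite sum_delta.
Qed.

Lemma jet2_sqnorm z i :
  jet2 (fun t => sqnorm (z + t *: delta_mx 0 i)) 0 (2 * z 0 i) 2.
Proof.
have -> : (fun t => sqnorm (z + t *: delta_mx 0 i)) =
    (fun t => sqnorm z + t * (2 * z 0 i) + (0 + t * 1) * (0 + t * 1)).
  apply/funext => t; rewrite /sqnorm.
  under eq_bigr do rewrite line_coord.
  have -> : \sum_j (z 0 j + t * (i == j)%:R) ^+ 2 =
      \sum_j z 0 j ^+ 2 + \sum_j (j == i)%:R * (t * (2 * z 0 j) + t ^+ 2).
    rewrite -big_split /=; apply: eq_bigr => j _; rewrite (eq_sym j).
    by case: (i == j); rewrite /=; ring.
  by rewrite sum_delta; ring.
apply: jet2_ext (jet2D (jet2_affine _ _ _)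
  (jet2M (jet2_affine _ _ _) (jet2_affine _ _ _))) _ _; ring.
Qed.

Lemma jet2_sqnorm_center y x0 i :
  jet2 (fun t => sqnorm (y + t *: delta_mx 0 i - x0)) 0 (2 * (y - x0) 0 i) 2.
Proof.
rewrite (_ : (fun t => _) = (fun t => sqnorm (y - x0 + t *: delta_mx 0 i))).
  exact: jet2_sqnorm.
by apply/funext => t; rewrite addrAC.
Qed.

Lemma sum_sq_coef z (b c : R) :
  \sum_i (b * z 0 i ^+ 2 + c) = b * sqnorm z + n.+1%:R * c.
Proof.
by rewrite big_split /= -mulr_sumr sumr_const card_ord mulr_natl.
Qed.

(** From the sum over i of the second derivatives, 4 q G'' + 2 N G', and from the
    drift, (a / y_N) 2 (y_N - x0_N) G', which is 2 a G' exactly because the centre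
    x0 lies on the boundary. *)
Lemma has_wlap_radial (G G1 : R -> R) (G2 : R) x0 y :
  last_coord x0 = 0 -> half_space y ->
  (\forall q \near sqnorm (y - x0), is_derive (q : R) 1 G (G1 q)) ->
  is_derive (sqnorm (y - x0)) 1 G1 G2 ->
  has_wlap (fun x => G (sqnorm (x - x0))) y
    (4 * sqnorm (y - x0) * G2 + 2 * (n.+1%:R + a) * G1 (sqnorm (y - x0))).
Proof.
move=> x00 hy Gd G1d.
set q := sqnorm (y - x0) in Gd G1d *.
have y0 : last_coord y != 0 by rewrite gt_eqF.
have yx0 : (y - x0) 0 ord_max = last_coord y.
  by rewrite !mxE -[x0 0 _]/(last_coord x0) x00 subr0.
exists (fun i => G1 q * (2 * (y - x0) 0 i)),
       (fun i => G2 * (2 * (y - x0) 0 i) ^+ 2 + G1 q * 2); split.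
  move=> i.
  have := jet2_comp (jet2_sqnorm_center y x0 i) (F := G) (F1 := G1) (F2 := G2).
  by rewrite scale0r addr0; apply.
have -> : \sum_i (G2 * (2 * (y - x0) 0 i) ^+ 2 + G1 q * 2) =
    \sum_i ((4 * G2) * (y - x0) 0 i ^+ 2 + G1 q * 2).
  by apply: eq_bigr => i _; ring.
rewrite sum_sq_coef -/q yx0.
by field.
Qed.

Definition inversion (x0 : 'rV[R]_n.+1) (m : R) y : 'rV[R]_n.+1 :=
  x0 + (m / sqnorm (y - x0)) *: (y - x0).

Lemma sqnorm_gt0 z j : z 0 j != 0 -> 0 < sqnorm z.
Proof.
move=> zj; rewrite /sqnorm (bigD1 j)//= ltr_wpDr ?exprn_even_gt0//.
by apply: sumr_ge0 => i _; exact: sqr_ge0.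
Qed.

Lemma sqnorm_center_gt0 x0 y : last_coord x0 = 0 -> half_space y ->
  0 < sqnorm (y - x0).
Proof.
move=> x00 hy; apply: (@sqnorm_gt0 _ ord_max).
by rewrite !mxE -[x0 0 _]/(last_coord x0) x00 subr0 gt_eqF.
Qed.

Lemma inversion_last x0 (m : R) y : last_coord x0 = 0 ->
  last_coord (inversion x0 m y) = m / sqnorm (y - x0) * last_coord y.
Proof.
move=> x00; rewrite /last_coord !mxE -![x0 0 _]/(last_coord x0) x00.
by rewrite subr0 add0r.
Qed.

Lemma jet2_inversion x0 (m : R) y i j : 0 < sqnorm (y - x0) ->
  let q := sqnorm (y - x0) in let z := y - x0 in
  jet2 (fun t => inversion x0 m (y + t *: delta_mx 0 i) 0 j) 0
    ((i == j)%:R * (m / q) - 2 * m / q ^+ 2 * z 0 i * z 0 j)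
    (- 4 * m / q ^+ 2 * (i == j)%:R * z 0 i +
       z 0 j * (8 * m / q ^+ 3 * z 0 i ^+ 2 - 2 * m / q ^+ 2)).
Proof.
move=> q0 /=; set q := sqnorm _ in q0 *; set z := y - x0.
have Gd : \forall s \near q, is_derive (s : R) 1 (fun s => m * s^-1) (- m * s ^- 2).
  near=> s.
  have s0 : s != 0 by rewrite gt_eqF//; near: s; exact: lt_nbhsr.
  apply: is_derive_eq (is_derive_mulf (is_derive_cst m s 1)
    (is_derive_invf (is_derive_id s 1) s0)) _.
  by rewrite /cst /=; field.
have q00 : q ^+ 2 != 0 by rewrite expf_neq0// gt_eqF.
have G1d : is_derive q 1 (fun s => - m * s ^- 2) (2 * m / q ^+ 3).
  apply: is_derive_eq (is_derive_mulf (is_derive_cst (- m) q 1)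
    (is_derive_invf (is_derive_mulf (is_derive_id q 1) (is_derive_id q 1)) q00)) _.
  by rewrite /cst /=; field; rewrite gt_eqF.
have Jq := @jet2_comp _ (fun s => m * s^-1) (fun s => - m * s ^- 2) (2 * m / q ^+ 3)
  _ _ _ _ (jet2_sqnorm_center y x0 i).
rewrite scale0r addr0 in Jq; have {}Jq := Jq Gd G1d.
have := jet2D (jet2_cst (x0 0 j) 0) (jet2M Jq (jet2_affine (z 0 j) (i == j)%:R 0)).
rewrite scale0r addr0 -/q mul0r addr0.
rewrite (_ : (fun t => _ + _) =
  (fun t => inversion x0 m (y + t *: delta_mx 0 i) 0 j)); last first.
  apply/funext => t; rewrite /inversion !mxE eqxx /= eq_sym /z ?mxE.
  by ring.
move=> J; apply: jet2_ext J _ _; rewrite -/z; field; rewrite gt_eqF //.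
Unshelve. all: by end_near. Qed.

Lemma is_derive_log (F F1 : R -> R) (m q : R) : 0 < m -> 0 < q ->
  is_derive (ln (q / m)) 1 F (F1 (ln (q / m))) ->
  is_derive q 1 (fun q => F (ln (q / m))) (F1 (ln (q / m)) / q).
Proof.
move=> m0 q0 Fd.
have qm0 : 0 < q / m by exact: divr_gt0.
have d1 : is_derive q 1 (fun q => q / m) m^-1.
  apply: is_derive_eq (is_derive_mulf (is_derive_id q 1) (is_derive_cst m^-1 q 1)) _.
  by rewrite /cst /=; ring.
have d2 := @is_derive1_comp _ (@ln R) (fun q => q / m) q _ _ (is_derive1_ln qm0) d1.
apply: is_derive_eq (@is_derive1_comp _ F (fun q => ln (q / m)) q _ _ Fd d2) _.
by field; rewrite !gt_eqF.
Qed.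

(** N - 2 + a, as the dimension is N = n + 1: the exponent for which |x|^(- kexp)
    solves the equation. *)
Definition kexp : R := n%:R - 1 + a.

(** In the variable s = ln (q / m) the operator has constant coefficients on radial
    functions; barriers and Kelvin weights are therefore written in terms of s. *)
Lemma has_wlap_logradial (F F1 : R -> R) (F2 m : R) x0 y :
  last_coord x0 = 0 -> half_space y -> 0 < m ->
  let q := sqnorm (y - x0) in let s := ln (q / m) in
  (\forall s \near s, is_derive (s : R) 1 F (F1 s)) ->
  is_derive s 1 F1 F2 ->
  has_wlap (fun x => F (ln (sqnorm (x - x0) / m))) y
    ((4 * F2 + 2 * kexp * F1 s) / q).
Proof.
move=> x00 hy m0 q s Fd F1d.
have q0 : 0 < q by exact: sqnorm_center_gt0.
have qm0 : 0 < q / m by exact: divr_gt0.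
have lc : {for q, continuous (fun q : R => ln (q / m))}.
  apply: (@continuous_comp _ _ _ (fun q : R => q / m) (@ln R)).
    by apply: continuousM => //; exact: cst_continuous.
  exact: continuous_ln.
apply: has_wlap_eq (@has_wlap_radial (fun q => F (ln (q / m)))
  (fun q => F1 (ln (q / m)) / q) ((F2 - F1 s) / q ^+ 2) x0 y x00 hy _ _) _.
- have Fs : \forall q' \near q, is_derive (ln (q' / m)) 1 F (F1 (ln (q' / m))).
    exact: lc _ Fd.
  near=> q'; apply: is_derive_log => //; last by near: q'; exact: Fs.
  by near: q'; exact: lt_nbhsr.
- have d1 := is_derive_log (F := F1) (F1 := fun=> F2) m0 q0 F1d.
  apply: is_derive_eq (is_derive_mulf d1
    (is_derive_invf (is_derive_id q 1) (lt0r_neq0 q0))) _.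
  by rewrite /= -/q -/s; field; rewrite gt_eqF.
- by rewrite -/q -/s /kexp -natr1; field; rewrite gt_eqF.
Unshelve. all: by end_near. Qed.

(** (q / m) ^ (- kexp / 2), through [expR] and [ln] to keep derivatives simple. *)
Definition kweight (m q : R) : R := expR (- (kexp / 2) * ln (q / m)).

Definition kelvin (U : 'rV[R]_n.+1 -> R) x0 m y : R :=
  kweight m (sqnorm (y - x0)) * U (inversion x0 m y).

Lemma is_derive_expR_scale (b s : R) :
  is_derive s 1 (fun s => expR (b * s)) (b * expR (b * s)).
Proof.
have d1 : is_derive s 1 (fun s => b * s) b.
  apply: is_derive_eq (is_derive_mulf (is_derive_cst b s 1) (is_derive_id s 1)) _.
  by rewrite /cst /=; ring.
apply: is_derive_eq (@is_derive1_comp _ expR (fun s => b * s) s _ _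
  (is_derive_expR _) d1) _.
by rewrite mulrC.
Qed.

Lemma is_derive_kweight (m q : R) : 0 < m -> 0 < q ->
  is_derive q 1 (kweight m) (- (kexp / 2) * kweight m q / q).
Proof.
move=> m0 q0.
exact: (is_derive_log (F := fun s => expR (- (kexp / 2) * s))
  (F1 := fun s => - (kexp / 2) * expR (- (kexp / 2) * s)) m0 q0
  (is_derive_expR_scale _ _)).
Qed.

(** The inversion is conformal: its Jacobian is m / q times an orthogonal matrix
    (sump), so the Laplacian of U is multiplied by (m / q)^2; so is the drift term,
    because the image c has height (m / q) y_N, and the two cancel.  The other
    gradient terms are multiples of g, which is q / m times the derivative of U
    at c in the direction c - x0, and cancel by the choice of the exponent; the
    terms in U cancel since the weight itself solves the equation. *)
Lemma has_wlap_kelvin U d dd x0 (m : R) y :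
  C2_on (@half_space R n) U d dd ->
  (forall x, half_space x ->
     \sum_j dd j j x + a / last_coord x * d ord_max x = 0) ->
  last_coord x0 = 0 -> half_space y -> 0 < m ->
  has_wlap (kelvin U x0 m) y 0.
Proof.
move=> UC Ueq x00 hy m0.
have q0 : 0 < sqnorm (y - x0) by exact: sqnorm_center_gt0.
set q := sqnorm (y - x0) in q0 *; set z := y - x0.
set c := inversion x0 m y.
have hc : half_space c.
  by rewrite /half_space /= inversion_last// mulr_gt0// divr_gt0.
pose b : R := - 2 * m / q ^+ 2.
pose p i j : R := (i == j)%:R * (m / q) + b * z 0 i * z 0 j.
pose r i j : R := 2 * b * (i == j)%:R * z 0 i +
  z 0 j * (8 * m / q ^+ 3 * z 0 i ^+ 2 + b).
pose E := kweight m q.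
pose E1 := - (kexp / 2) * E / q.
pose E2 := kexp / 2 * (kexp / 2 + 1) * E / q ^+ 2.
pose V1 i := \sum_j d j c * p i j.
pose V2 i := \sum_j ((\sum_l dd j l c * p i l) * p i j + d j c * r i j).
have y00 i : y + 0 *: delta_mx 0 i = y by rewrite scale0r addr0.
have jE i : jet2 (fun t => kweight m (sqnorm (y + t *: delta_mx 0 i - x0))) 0
    (E1 * (2 * z 0 i)) (E2 * (2 * z 0 i) ^+ 2 + E1 * 2).
  have := @jet2_comp _ (kweight m) (fun q => - (kexp / 2) * kweight m q / q) E2
    _ _ _ _ (jet2_sqnorm_center y x0 i).
  rewrite y00; apply.
    near=> s; apply: is_derive_kweight => //.
    by near: s; exact: lt_nbhsr.
  apply: is_derive_eq (is_derive_mulf (is_derive_mulf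
    (is_derive_cst (- (kexp / 2)) q 1) (is_derive_kweight m0 q0))
    (is_derive_invf (is_derive_id q 1) (lt0r_neq0 q0))) _.
  by rewrite /cst /= /E2 -/E; field; rewrite gt_eqF.
have jV i : jet2 (fun t => U (inversion x0 m (y + t *: delta_mx 0 i))) 0
    (V1 i) (V2 i).
  have jc j : jet2 (fun t => inversion x0 m (y + t *: delta_mx 0 i) 0 j) 0
      (p i j) (r i j).
    apply: jet2_ext (jet2_inversion m i j q0) _ _; rewrite /p /r /b -/q -/z;
      by field; rewrite gt_eqF.
  have := @jet2_curve _ _ _ _ _ _ (fun t => inversion x0 m (y + t *: delta_mx 0 i))
    _ _ _ open_half_space _ UC jc.
  by rewrite y00; apply.
exists (fun i => E1 * (2 * z 0 i) * U c + E * V1 i),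
  (fun i => (E2 * (2 * z 0 i) ^+ 2 + E1 * 2) * U c +
    2 * (E1 * (2 * z 0 i) * V1 i) + E * V2 i); split.
  by move=> i; have := jet2M (jE i) (jV i); rewrite y00.
pose g := \sum_j d j c * z 0 j.
have V1E i : V1 i = d i c * (m / q) + g * b * z 0 i.
  rewrite /V1 /p /g -mulrA mulr_suml.
  under eq_bigr do rewrite mulrDr mulrCA eq_sym.
  rewrite big_split /= sum_delta; congr (_ + _).
  by apply: eq_bigr => j _; ring.
(* The inversion reverses the radial direction, whence the sign. *)
have zV1 : \sum_i z 0 i * V1 i = - (g * (m / q)).
  under eq_bigr do rewrite V1E.
  have -> : \sum_i z 0 i * (d i c * (m / q) + g * b * z 0 i) =
      \sum_i d i c * z 0 i * (m / q) + g * b * \sum_i z 0 i ^+ 2.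
    by rewrite mulr_sumr -big_split; apply: eq_bigr => i _ /=; ring.
  rewrite -mulr_suml -/g -[\sum_i z 0 i ^+ 2]/q /b.
  by field; rewrite gt_eqF.
have sump j l : \sum_i p i l * p i j = (l == j)%:R * (m / q) ^+ 2.
  have -> : \sum_i p i l * p i j =
      \sum_i (i == l)%:R * ((i == j)%:R * (m / q) ^+ 2 + b * (m / q) * z 0 i * z 0 j)
      + \sum_i (i == j)%:R * (b * (m / q) * z 0 i * z 0 l)
      + b ^+ 2 * z 0 l * z 0 j * \sum_i z 0 i ^+ 2.
    by rewrite mulr_sumr -!big_split; apply: eq_bigr => i _ /=; rewrite /p; ring.
  rewrite !sum_delta -[\sum_i z 0 i ^+ 2]/q /b.
  by field; rewrite gt_eqF.
have sumr j : \sum_i r i j = b * (n%:R - 1) * z 0 j.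
  have -> : \sum_i r i j = \sum_i (i == j)%:R * (2 * b * z 0 i) +
      z 0 j * \sum_i (8 * m / q ^+ 3 * z 0 i ^+ 2 + b).
    by rewrite mulr_sumr -big_split; apply: eq_bigr => i _ /=; rewrite /r; ring.
  rewrite sum_delta sum_sq_coef.
  rewrite -[sqnorm z]/q /b -natr1.
  by field; rewrite gt_eqF.
have sumV2 : \sum_i V2 i = (m / q) ^+ 2 * (\sum_j dd j j c) + b * (n%:R - 1) * g.
  rewrite /V2 exchange_big /= /g !mulr_sumr -big_split; apply: eq_bigr => j _ /=.
  rewrite big_split /= -mulr_sumr sumr; congr (_ + _); last by ring.
  under eq_bigr do rewrite mulr_suml.
  rewrite exchange_big /=.
  under eq_bigr => l _.
    under eq_bigr do rewrite -mulrA.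
    rewrite -mulr_sumr sump mulrCA; over.
  by rewrite sum_delta mulrC.
have -> : \sum_i ((E2 * (2 * z 0 i) ^+ 2 + E1 * 2) * U c +
    2 * (E1 * (2 * z 0 i) * V1 i) + E * V2 i) =
    U c * \sum_i (4 * E2 * z 0 i ^+ 2 + E1 * 2) +
    4 * E1 * (\sum_i z 0 i * V1 i) + E * \sum_i V2 i.
  by rewrite !mulr_sumr -!big_split; apply: eq_bigr => i _ /=; ring.
rewrite sum_sq_coef zV1 sumV2 V1E -[sqnorm z]/q.
have zy : z 0 ord_max = last_coord y.
  by rewrite /z !mxE -[x0 0 _]/(last_coord x0) x00 subr0.
have y0 : last_coord y != 0 by rewrite gt_eqF.
have := Ueq c hc; rewrite {1}/c inversion_last// -/q => /eqP.
rewrite addr_eq0 => /eqP ->.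
rewrite zy /E1 /E2 /b -natr1 /kexp.
by field; rewrite !gt_eqF.
Unshelve. all: by end_near. Qed.

End WeightedLaplacian.

(** * The minimum principle outside a half ball *)

Section MovingSpheres.
Context {R : realType} {n : nat}.
Variable a : R.
Implicit Types (x y z : 'rV[R]_n.+1).

Lemma sqnorm_continuous : continuous (@sqnorm R n).
Proof.
rewrite /sqnorm; apply: (@continuous_big _ _ _ _ _ add_continuous) => j _ x.
have cj : {for x, continuous (fun x => x 0 j)} by exact: coord_continuous.
exact: (continuousM cj cj).
Qed.

Lemma sqnorm_center_continuous x0 :
  continuous (fun x => sqnorm (x - x0) : R).
Proof.
move=> x; apply: (@continuous_comp _ _ _ (fun x => x - x0) (@sqnorm R n)).
  by apply: continuousB; [by move=> A|exact: cst_continuous].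
exact: sqnorm_continuous.
Qed.

Lemma sqnorm_ge0 z : 0 <= sqnorm z.
Proof. by apply: sumr_ge0 => j _; exact: sqr_ge0. Qed.

Lemma coord_le_sqnorm z j : z 0 j ^+ 2 <= sqnorm z.
Proof.
rewrite /sqnorm (bigD1 j)//= lerDl.
by apply: sumr_ge0 => i _; exact: sqr_ge0.
Qed.

Lemma closed_half_space_closed : closed (@closed_half_space R n).
Proof.
have -> : @closed_half_space R n = (fun x => x 0 ord_max) @^-1` [set t | 0 <= t].
  by [].
apply: preimage_closed; last exact: closed_ge.
by move=> x _; exact: coord_continuous.
Qed.

Definition half_annulus x0 (m Q : R) : set 'rV[R]_n.+1 :=
  [set y | closed_half_space y /\ m <= sqnorm (y - x0) <= Q].

Lemma half_annulus_compact x0 m Q : compact (half_annulus x0 m Q).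
Proof.
apply: bounded_closed_compact.
  exists (`|x0| + (Q + 1)); split; first exact: num_real.
  move=> M ltM y [_ /andP[_ yQ]]; apply: (le_trans _ (ltW ltM)).
  rewrite -[y](subrK x0) addrC (le_trans (ler_normD _ _))// lerD2l.
  have Q0 : 0 <= Q by exact: le_trans (sqnorm_ge0 _) yQ.
  rewrite [leLHS]/Num.Def.normr/= mx_normrE; apply: bigmax_le => [|[i j] _].
    by rewrite addr_ge0.
  rewrite ord1 /=; have := le_trans (coord_le_sqnorm _ j) yQ.
  by rewrite -real_normK ?num_real//; move: (`|_|) => t; nra.
have -> : half_annulus x0 m Q = (@closed_half_space R n) `&`
    (((fun y => sqnorm (y - x0)) @^-1` [set t | m <= t]) `&`
     ((fun y => sqnorm (y - x0)) @^-1` [set t | t <= Q])).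
  by rewrite predeqE => y; split=> [[? /andP[]]|[? [? ?]]]; split=> //; apply/andP.
apply: closedI; first exact: closed_half_space_closed.
apply: closedI; apply: preimage_closed => //; try exact: closed_ge;
  try exact: closed_le; by move=> y _; exact: sqnorm_center_continuous.
Qed.

(** A negative value would give a negative minimum on the compact half annulus
    m <= |y - x0|^2 <= Q.  It is attained away from the two spheres and from the
    boundary hyperplane, where strict supersolutions have no minimum. *)
Lemma exterior_min W x0 (m Q : R) :
  {within [set y | closed_half_space y /\ m <= sqnorm (y - x0)], continuous W} ->
  (forall y, half_space y -> m < sqnorm (y - x0) ->
     exists2 l, l < 0 & has_wlap a W y l) ->
  (forall y, closed_half_space y -> sqnorm (y - x0) = m -> 0 <= W y) ->
  (forall y, half_space_boundary y -> m <= sqnorm (y - x0) -> 0 <= W y) ->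
  (forall y, closed_half_space y -> Q <= sqnorm (y - x0) -> 0 <= W y) ->
  forall y, closed_half_space y -> m <= sqnorm (y - x0) -> 0 <= W y.
Proof.
move=> Wc Wl Wm Wb WQ y yh my; rewrite leNgt; apply/negP => Wy.
have yQ : sqnorm (y - x0) < Q.
  by rewrite ltNge; apply/negP => /(WQ _ yh); rewrite leNgt Wy.
have [||w] := @EVT_min_rV R n.+1 W (half_annulus x0 m Q) _ (@half_annulus_compact _ _ _).
- by exists y; split=> //; rewrite my ltW.
- by apply: continuous_subspaceW Wc => z [zh /andP[mz _]]; split.
rewrite inE => -[wh /andP[mw wQ]] wmin.
have Ww : W w < 0.
  by apply: le_lt_trans Wy; apply: wmin; rewrite inE; split=> //; rewrite my ltW.
have {}mw : m < sqnorm (w - x0).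
  rewrite lt_neqAle mw andbT; apply/eqP => E.
  by have := Wm w wh (esym E); rewrite leNgt Ww.
have {}wQ : sqnorm (w - x0) < Q.
  rewrite lt_neqAle wQ andbT; apply/eqP => E.
  by have := WQ w wh; rewrite E lexx leNgt Ww => /(_ isT).
have {}wh : half_space w.
  rewrite /half_space /= lt_neqAle [_ <= _]wh andbT; apply/eqP => E.
  by have := Wb w (esym E) (ltW mw); rewrite leNgt Ww.
have [l l0 Wwl] := Wl w wh mw.
suff : 0 <= l by rewrite leNgt l0.
apply: (has_wlap_min wh Wwl).
have qc := @sqnorm_center_continuous x0 w.
have n1 : nbhs w (@half_space R n) 
  by apply: open_nbhs_nbhs; split; [exact: open_half_space|exact: wh].
have n2 : nbhs w [set z | m < sqnorm (z - x0)] by exact: (cvgr_gt _ qc).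
have n3 : nbhs w [set z | sqnorm (z - x0) < Q] by exact: (cvgr_lt _ qc).
apply: filterS (filterI n1 (filterI n2 n3)) => z [zh [zm zQ]].
apply: wmin; rewrite inE; split; first exact: ltW zh.
by rewrite !ltW.
Qed.

Lemma sqnorm_inversion x0 (m : R) y : 0 < sqnorm (y - x0) ->
  sqnorm (inversion x0 m y - x0) = m ^+ 2 / sqnorm (y - x0).
Proof.
move=> q0; rewrite /inversion addrAC subrr add0r.
rewrite {1}/sqnorm; under eq_bigr do rewrite mxE exprMn.
by rewrite -mulr_sumr -/(sqnorm _); field; rewrite gt_eqF.
Qed.

Lemma inversion_continuous x0 (m : R) y : 0 < sqnorm (y - x0) ->
  {for y, continuous (inversion x0 m)}.
Proof.
move=> q0; rewrite /inversion.
apply: continuousD; first exact: cst_continuous.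
apply: (@continuousZ _ _ _ (fun y => m / sqnorm (y - x0)) (fun y => y - x0)).
  apply: continuousM; first exact: cst_continuous.
  by apply: continuousV; [rewrite gt_eqF|exact: sqnorm_center_continuous].
by apply: continuousB; [by move=> A|exact: cst_continuous].
Qed.

End MovingSpheres.

(** * Comparing a solution with its Kelvin transform *)

Section KelvinComparison.
Context {R : realType} {n : nat}.
Variable a : R.
Variables (U : 'rV[R]_n.+1 -> R) (d : 'I_n.+1 -> 'rV[R]_n.+1 -> R)
  (dd : 'I_n.+1 -> 'I_n.+1 -> 'rV[R]_n.+1 -> R).
Hypothesis UC2 : C2_on (@half_space R n) U d dd.
Hypothesis Ueq : forall x, half_space x ->
  \sum_j dd j j x + a / last_coord x * d ord_max x = 0.
Hypothesis UC0 : {within @closed_half_space R n, continuous U}.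
Implicit Types (x y z : 'rV[R]_n.+1).
Local Notation k := (kexp (n := n) a).

Lemma continuous_within_cvg (T : topologicalType) (D : set T) (f : T -> R) (y : T) :
  {for y, continuous f} -> f x @[x --> within D (nbhs y)] --> f y.
Proof.
by move=> fc; apply: cvg_trans fc; apply: cvg_app; exact: cvg_within.
Qed.

Lemma inversion_closed x0 (m : R) y : last_coord x0 = 0 -> 0 < m ->
  closed_half_space y -> closed_half_space (inversion x0 m y).
Proof.
move=> x00 m0 yh; rewrite /closed_half_space /= inversion_last//.
by rewrite mulr_ge0// divr_ge0 ?sqnorm_ge0 ?ltW.
Qed.

Lemma log_center_continuous x0 (m : R) y : 0 < m -> 0 < sqnorm (y - x0) ->
  {for y, continuous (fun y => ln (sqnorm (y - x0) / m))}.
Proof.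
move=> m0 q0.
apply: (@continuous_comp _ _ _ (fun y => sqnorm (y - x0) / m) (@ln R)).
  by apply: continuousM; [exact: sqnorm_center_continuous|exact: cst_continuous].
by apply: continuous_ln; exact: divr_gt0.
Qed.

Lemma kelvin_within_continuous x0 (m : R) : last_coord x0 = 0 -> 0 < m ->
  {within [set y | closed_half_space y /\ m <= sqnorm (y - x0)],
     continuous (kelvin a U x0 m)}.
Proof.
move=> x00 m0; apply/subspace_continuousP => y [yh my].
have q0 : 0 < sqnorm (y - x0) by exact: lt_le_trans my.
have wc : {for y, continuous (fun y => kweight (n := n) a m (sqnorm (y - x0)))}.
  rewrite /kweight; apply: (@continuous_comp _ _ _
    (fun y => - (k / 2) * ln (sqnorm (y - x0) / m)) (@expR R)).
    by apply: continuousM; [exact: cst_continuous|exact: log_center_continuous].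
  exact: continuous_expR.
rewrite /kelvin; apply: cvgM.
  exact: continuous_within_cvg wc.
have /subspace_continuousP/(_ _ (inversion_closed x00 m0 yh)) := UC0.
move=> H V /H /= HV.
exact: (@filterS _ (nbhs y) (nbhs_filter y) _ _
  (fun z Hz hz => Hz (inversion_closed x00 m0 (proj1 hz)))
  (@inversion_continuous _ _ x0 m y q0 _ HV)).
Qed.

Lemma inversion_sphere x0 (m : R) y : 0 < m -> sqnorm (y - x0) = m ->
  inversion x0 m y = y.
Proof.
by move=> m0 E; rewrite /inversion E divff ?gt_eqF// scale1r addrCA subrr addr0.
Qed.

Lemma kelvin_sphere x0 (m : R) y : 0 < m -> sqnorm (y - x0) = m ->
  kelvin a U x0 m y = U y.
Proof.
move=> m0 E; rewrite /kelvin inversion_sphere// /kweight E divff ?gt_eqF//.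
by rewrite ln1 mulr0 expR0 mul1r.
Qed.

(** The radial barrier F, a strict supersolution by has_wlap_logradial, turns
    U minus its Kelvin transform into a strict supersolution however small its
    coefficient e is; it also compensates at infinity.  Then e tends to 0. *)
Lemma kelvin_le_of_barrier (F F1 F2 : R -> R) x0 (m : R) :
  last_coord x0 = 0 -> 0 < m ->
  (forall s : R, - 1 < s -> is_derive s 1 F (F1 s)) ->
  (forall s : R, 0 < s -> is_derive s 1 F1 (F2 s)) ->
  (forall s : R, 0 < s -> 2 * F2 s + k * F1 s < 0) ->
  (forall s : R, 0 <= s -> 0 <= F s) ->
  (forall y, half_space_boundary y -> m <= sqnorm (y - x0) ->
     kelvin a U x0 m y <= U y) ->
  (forall e : R, 0 < e -> exists Q : R, forall y, closed_half_space y ->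
     m <= sqnorm (y - x0) -> Q <= sqnorm (y - x0) ->
     kelvin a U x0 m y <= U y + e * F (ln (sqnorm (y - x0) / m))) ->
  forall y, closed_half_space y -> m <= sqnorm (y - x0) ->
    kelvin a U x0 m y <= U y.
Proof.
move=> x00 m0 Fd F1d Fneg F0 Kb Kinf.
have s0 y : m <= sqnorm (y - x0) -> 0 <= ln (sqnorm (y - x0) / m).
  by move=> my; rewrite ln_ge0// ler_pdivlMr// mul1r.
have main (e : R) : 0 < e -> forall y, closed_half_space y ->
    m <= sqnorm (y - x0) ->
    0 <= U y + (- 1 * kelvin a U x0 m y + e * F (ln (sqnorm (y - x0) / m))).
  move=> e0; have [Q HQ] := Kinf e e0.
  apply: (exterior_min (a := a) (Q := Num.max m Q)).
  - apply/subspace_continuousP => y [yh my].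
    have q0 : 0 < sqnorm (y - x0) by exact: lt_le_trans my.
    apply: cvgD; last apply: cvgD.
    + have /subspace_continuousP/(_ y yh) := UC0.
      by apply: cvg_trans; apply: cvg_app; apply: within_subset => z [].
    + apply: cvgM; first exact: cvg_cst.
      by have /subspace_continuousP := kelvin_within_continuous x00 m0; apply.
    + apply: cvgM; first exact: cvg_cst.
      apply: continuous_within_cvg.
      apply: (@continuous_comp _ _ _ (fun y => ln (sqnorm (y - x0) / m)) F).
        exact: log_center_continuous.
      apply/differentiable_continuous/derivable1_diffP.
      by case: (Fd (ln (sqnorm (y - x0) / m)) (lt_le_trans _ (s0 y my))).
  - move=> y yh my.
    have q0 : 0 < sqnorm (y - x0) by exact: lt_trans my.
    have s00 : 0 < ln (sqnorm (y - x0) / m).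
      by rewrite ln_gt0// ltr_pdivlMr// mul1r.
    exists (0 + (- 1 * 0 + e * ((4 * F2 (ln (sqnorm (y - x0) / m)) +
        2 * k * F1 (ln (sqnorm (y - x0) / m))) / sqnorm (y - x0)))).
      rewrite mulr0 !add0r pmulr_rlt0// pmulr_llt0 ?invr_gt0//.
      by have := Fneg _ s00; lra.
    apply: has_wlapD.
      by apply: has_wlap_eq (has_wlap_C2 a yh UC2) _; exact: Ueq.
    apply: has_wlapD; apply: has_wlapZ.
      exact: has_wlap_kelvin UC2 Ueq x00 yh m0.
    apply: has_wlap_logradial => //; last exact: F1d.
    near=> s; apply: Fd; apply: lt_trans (_ : 0 < s); first lra.
    by near: s; exact: lt_nbhsr.
  - move=> y yh ym; rewrite kelvin_sphere// mulN1r addNKr.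
    by apply: mulr_ge0; [exact: ltW|rewrite F0// s0// ym].
  - move=> y yb my; rewrite mulN1r addrA addr_ge0 ?subr_ge0 ?Kb//.
    by apply: mulr_ge0; [exact: ltW|rewrite F0// s0].
  - move=> y yh; rewrite ge_max => /andP[my Qy].
    by rewrite mulN1r addrCA addrC subr_ge0 HQ.
move=> y yh my; apply/ler_addgt0Pr => e e0.
set s := ln (sqnorm (y - x0) / m).
have F10 : 0 < F s + 1 by rewrite ltr_wpDl// F0// s0.
have := main (e / (F s + 1)) (divr_gt0 e0 F10) y yh my; rewrite -/s.
have : e / (F s + 1) * F s <= e.
  by rewrite mulrAC ler_pdivrMr// ler_pM2l// lerDl.
by lra.
Unshelve. all: by end_near. Qed.

End KelvinComparison.

(** * The moving sphere inequality *)

Section MovingSpheresConclusion.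
Context {R : realType} {n : nat}.
Variable a : R.
Variables (U : 'rV[R]_n.+1 -> R) (d : 'I_n.+1 -> 'rV[R]_n.+1 -> R)
  (dd : 'I_n.+1 -> 'I_n.+1 -> 'rV[R]_n.+1 -> R).
Hypothesis UC2 : C2_on (@half_space R n) U d dd.
Hypothesis Ueq : forall x, half_space x ->
  \sum_j dd j j x + a / last_coord x * d ord_max x = 0.
Hypothesis UC0 : {within @closed_half_space R n, continuous U}.
Implicit Types (x y z : 'rV[R]_n.+1).
Local Notation k := (kexp (n := n) a).

(** Far points are mapped close to the centre, where U is close to U x0. *)
Lemma inversion_at_infinity x0 (m e : R) : last_coord x0 = 0 -> 0 < m ->
  0 < e -> exists2 Q : R, 0 < Q & forall y, closed_half_space y ->
    Q <= sqnorm (y - x0) -> U (inversion x0 m y) <= U x0 + e.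
Proof.
move=> x00 m0 e0.
have x0h : closed_half_space x0 by rewrite /closed_half_space /= x00.
have /subspace_continuousP/(_ x0 x0h)/cvgrPdist_le/(_ e e0) := UC0.
move=> /nbhs_ballP[r /= r0 Hr].
exists (4 * m ^+ 2 / r ^+ 2) => [|y yh Qy].
  by rewrite divr_gt0 ?mulr_gt0 ?exprn_gt0.
have q0 : 0 < sqnorm (y - x0).
  by apply: lt_le_trans Qy; rewrite divr_gt0 ?mulr_gt0 ?exprn_gt0.
suff /Hr : ball x0 r (inversion x0 m y).
  by move=> /(_ (inversion_closed x00 m0 yh)); rewrite ler_distlC => /andP[].
split=> // i j; rewrite ord1 /ball /= distrC.
have := coord_le_sqnorm (inversion x0 m y - x0) j.
rewrite sqnorm_inversion// !mxE => zj.
have : m ^+ 2 / sqnorm (y - x0) < r ^+ 2.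
  rewrite ltr_pdivrMr//; move: Qy; rewrite ler_pdivrMr ?exprn_gt0// => Qy.
  have : 0 < m ^+ 2 by rewrite exprn_gt0.
  by lra.
move=> /(le_lt_trans zj); rewrite -[_ ^+ 2]real_normK ?num_real//.
by rewrite ltr_pXn2r// nnegrE ltW.
Qed.

Lemma le_log_center x0 (m L : R) y : 0 < m ->
  m * expR L <= sqnorm (y - x0) -> L <= ln (sqnorm (y - x0) / m).
Proof.
move=> m0 H; rewrite -[leLHS]expRK ler_ln ?posrE ?expR_gt0//.
  by rewrite ler_pdivlMr// mulrC.
by rewrite divr_gt0// (lt_le_trans _ H)// mulr_gt0// expR_gt0.
Qed.

Lemma inversion_boundary x0 (m : R) y : last_coord x0 = 0 -> half_space_boundary y ->
  half_space_boundary (inversion x0 m y).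
Proof.
by move=> x00 yb; rewrite /half_space_boundary /= inversion_last// yb mulr0.
Qed.

(** At infinity the Kelvin transform is at most (c + 1) exp (- k s / 2), which tends
    to 0, while U >= 0; so the constant term of the barrier suffices there, and
    exp (- k s / 4) makes it a strict supersolution. *)
Lemma kelvin_le_pos (c : R) x0 (m : R) : 0 < k -> 0 <= c ->
  (forall x, half_space_boundary x -> U x = c) ->
  (forall x, closed_half_space x -> 0 <= U x) ->
  last_coord x0 = 0 -> 0 < m ->
  forall y, closed_half_space y -> m <= sqnorm (y - x0) ->
    kelvin a U x0 m y <= U y.
Proof.
move=> k0 c0 Ub U0 x00 m0.
pose E (s : R) := expR (- (k / 4) * s).
have Ed (s : R) : is_derive s 1 E (- (k / 4) * E s) by exact: is_derive_expR_scale.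
apply: (kelvin_le_of_barrier UC2 Ueq UC0 (F := fun s => 1 + E s)
  (F1 := fun s => - (k / 4) * E s)
  (F2 := fun s => (k / 4) ^+ 2 * E s) x00 m0).
- move=> s _; apply: is_derive_eq (is_derive_addf (is_derive_cst (1 : R) s 1) (Ed s)) _.
  by rewrite add0r.
- move=> s _; apply: is_derive_eq
    (is_derive_mulf (is_derive_cst (- (k / 4)) s 1) (Ed s)) _.
  by rewrite /cst /=; ring.
- move=> s _; have Es : 0 < k ^+ 2 * E s by rewrite mulr_gt0 ?exprn_gt0 ?expR_gt0.
  have -> : 2 * ((k / 4) ^+ 2 * E s) + k * (- (k / 4) * E s) = - (k ^+ 2 * E s) / 8.
    by field.
  by lra.
- by move=> s _; rewrite addr_ge0// ltW// expR_gt0.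
- move=> y yb my; rewrite /kelvin !Ub//; last exact: (inversion_boundary m x00 yb).
  rewrite ler_piMl// -[leRHS]expR0 ler_expR mulNr oppr_le0 mulr_ge0//.
    by rewrite divr_ge0// ltW.
  by rewrite ln_ge0// ler_pdivlMr// mul1r.
- move=> e e0.
  have [Q1 Q10 HQ1] := @inversion_at_infinity x0 m 1 x00 m0 ltac:(by []).
  have c1 : 0 < c + 1 by rewrite ltr_wpDl.
  exists (Num.max Q1 (m * expR (- (2 / k) * ln (e / (c + 1))))) => y yh my.
  rewrite ge_max => /andP[/(HQ1 y yh) + /(le_log_center m0)].
  rewrite (Ub x0)// => Ui Ls.
  have w0 : 0 < kweight (n := n) a m (sqnorm (y - x0)) by exact: expR_gt0.
  have w1 : kweight (n := n) a m (sqnorm (y - x0)) <= e / (c + 1).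
    rewrite -[leRHS]lnK ?posrE ?divr_gt0// ler_expR.
    rewrite mulNr lerNl -ler_pdivrMl ?divr_gt0//.
    apply: le_trans Ls; rewrite le_eqVlt; apply/orP; left; apply/eqP.
    by field; rewrite gt_eqF.
  have Fs : 1 <= 1 + E (ln (sqnorm (y - x0) / m)) by rewrite lerDl ltW// expR_gt0.
  apply: (@le_trans _ _ e); last first.
    by rewrite (@le_trans _ _ (e * (1 + E (ln (sqnorm (y - x0) / m)))))//
      ?ler_peMr ?lerDr ?U0// ltW.
  rewrite /kelvin; apply: (@le_trans _ _ (e / (c + 1) * (c + 1))); last first.
    by rewrite divfK// gt_eqF.
  apply: ler_pM => //; first exact: ltW.
  by apply/U0/inversion_closed.
Qed.

(** In the barrier, exp (- k s / 2) is the growth of the Kelvin weight and solves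
    the equation; ln (1 + s) tends to infinity, so that it absorbs the lower bound
    of U, and is strictly concave and increasing in s, which makes the barrier a
    strict supersolution for k <= 0. *)
Lemma kelvin_le_neg (C : R) x0 (m : R) : k <= 0 ->
  (forall x, half_space_boundary x -> U x = 0) ->
  (forall x, closed_half_space x -> - C <= U x) ->
  last_coord x0 = 0 -> 0 < m ->
  forall y, closed_half_space y -> m <= sqnorm (y - x0) ->
    kelvin a U x0 m y <= U y.
Proof.
move=> k0 Ub UC x00 m0.
pose E (s : R) := expR (- (k / 2) * s).
have Ed (s : R) : is_derive s 1 E (- (k / 2) * E s) by exact: is_derive_expR_scale.
have sd (s : R) : is_derive s 1 (fun s => 1 + s) 1.
  apply: is_derive_eq (is_derive_addf (is_derive_cst (1 : R) s 1) (is_derive_id s 1)) _.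
  by rewrite add0r.
apply: (kelvin_le_of_barrier UC2 Ueq UC0 (F := fun s => E s + ln (1 + s))
  (F1 := fun s => - (k / 2) * E s + (1 + s)^-1)
  (F2 := fun s => (k / 2) ^+ 2 * E s - (1 + s) ^- 2) x00 m0).
- move=> s s1; have s10 : 0 < 1 + s by lra.
  have dln : is_derive s 1 (fun s => ln (1 + s)) (1 + s)^-1.
    apply: is_derive_eq (@is_derive1_comp _ (@ln R) (fun s => 1 + s) s _ _
      (is_derive1_ln s10) (sd s)) _.
    by rewrite mulr1.
  exact: (is_derive_addf (Ed s) dln).
- move=> s s0; have s10 : 1 + s != 0 by rewrite gt_eqF//; lra.
  apply: is_derive_eq (is_derive_addf
    (is_derive_mulf (is_derive_cst (- (k / 2)) s 1) (Ed s))
    (is_derive_invf (sd s) s10)) _.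
  by rewrite /cst /=; field.
- move=> s s0; have s10 : 0 < (1 + s)^-1 by rewrite invr_gt0; lra.
  have -> : 2 * ((k / 2) ^+ 2 * E s - (1 + s) ^- 2) +
      k * (- (k / 2) * E s + (1 + s)^-1) =
      k * (1 + s)^-1 - 2 * ((1 + s)^-1 * (1 + s)^-1).
    by field; rewrite gt_eqF//; lra.
  have : 0 < (1 + s)^-1 * (1 + s)^-1 by exact: mulr_gt0.
  have : k * (1 + s)^-1 <= 0 by rewrite pmulr_lle0.
  by lra.
- move=> s s0; apply: addr_ge0; first by rewrite ltW// expR_gt0.
  by rewrite ln_ge0// lerDl.
- by move=> y yb my; rewrite /kelvin !Ub ?mulr0//; exact: (inversion_boundary m x00 yb).
- move=> e e0.
  have [Q1 Q10 HQ1] := inversion_at_infinity x00 m0 e0.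
  exists (Num.max Q1 (m * expR (expR (C / e)))) => y yh my.
  rewrite ge_max => /andP[/(HQ1 y yh) + /(le_log_center m0)].
  rewrite (Ub x0)// add0r; set s := ln _ => Ui Ls.
  have lns : C <= e * ln (1 + s).
    rewrite -ler_pdivrMl// mulrC -[leLHS]expRK ler_ln ?posrE ?expR_gt0//.
      by rewrite (le_trans Ls)// lerDr.
    by rewrite (lt_le_trans (expR_gt0 (C / e)))// (le_trans Ls)// lerDr.
  have : kelvin a U x0 m y <= e * E s.
    by rewrite /kelvin mulrC ler_wpM2r// ltW// expR_gt0.
  by have := UC y yh; rewrite mulrDr; lra.
Qed.

(** For 0 < t < 1 the centre x0 below is chosen so that y is mapped to
    x0 + (1 - t) (y - x0) = z - t z_N e_N, a point of the vertical line through z.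
    As t tends to 0, this point tends to z and the weight tends to 1. *)
Lemma kelvin_le_horizontal y z :
  (forall x0 (m : R), last_coord x0 = 0 -> 0 < m ->
    forall y, closed_half_space y -> m <= sqnorm (y - x0) ->
    kelvin a U x0 m y <= U y) ->
  half_space y -> half_space z -> last_coord y = last_coord z -> U z <= U y.
Proof.
move=> K yh zh yz.
(* The Kelvin weight is written with - ln (1 - t), as m / q = 1 - t below. *)
pose h (t : R) := expR (- (k / 2) * - ln (1 - t)) *
  U (z + t *: (- last_coord z *: delta_mx 0 ord_max)).
have hc : {for (0 : R), continuous h}.
  apply: (@continuousM R R).
    apply: (@continuous_comp _ _ _ (fun t : R => - (k / 2) * - ln (1 - t)) (@expR R)).
      apply: continuousM; first exact: cst_continuous.
      apply: continuousN.
      apply: (@continuous_comp _ _ _ (fun t : R => 1 - t) (@ln R)).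
        by apply: continuousB; [exact: cst_continuous|by move=> A].
      by apply: continuous_ln; rewrite subr0.
    exact: continuous_expR.
  apply: (@continuous_comp _ _ _
    (fun t : R => z + t *: (- last_coord z *: delta_mx 0 ord_max)) U).
    by apply: continuousD; [exact: cst_continuous|exact: scalel_continuous].
  rewrite scale0r addr0.
  have : {within @half_space R n, continuous U}.
    by apply: continuous_subspaceW UC0 => x /ltW.
  rewrite continuous_open_subspace; last exact: open_half_space.
  by move=> H; apply: H; rewrite inE.
have h0 : h 0 = U z.
  by rewrite /h subr0 ln1 oppr0 mulr0 expR0 mul1r scale0r addr0.
rewrite -h0.
apply: (cvgr_to_le (cvg_at_right_filter hc)).
near=> t.
have t0 : 0 < t by [].
have t1 : t < 1 by near: t; exact: nbhs_right_lt.
pose x0 := z - last_coord z *: delta_mx 0 ord_max - ((1 - t) / t) *: (y - z).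
have x00 : last_coord x0 = 0.
  move: yz; rewrite /x0 /last_coord !mxE !eqxx /= => ->.
  by ring.
have q0 := sqnorm_center_gt0 x00 yh.
have := K x0 ((1 - t) * sqnorm (y - x0)) x00 (mulr_gt0 _ q0) y (ltW yh).
rewrite subr_gt0 => /(_ t1).
rewrite ger_pMl// gerBl => /(_ (ltW t0)).
apply: le_trans; rewrite le_eqVlt; apply/orP; left; apply/eqP.
rewrite /h /kelvin /kweight; congr (expR (_ * _) * U _).
  by rewrite -lnV ?posrE ?subr_gt0//; congr ln; field; rewrite !gt_eqF// subr_gt0.
rewrite /inversion mulfK ?gt_eqF//.
apply/rowP => j; rewrite /x0 !mxE !eqxx /=.
by field; rewrite gt_eqF.
Unshelve. all: by end_near. Qed.

End MovingSpheresConclusion.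

(** * Solutions depending on the height only *)

Section EulerODE.
Context {R : realType}.

Lemma derive0_constant_pos (g : R -> R) (s t : R) :
  (forall r : R, 0 < r -> is_derive r 1 g 0) -> 0 < s -> 0 < t -> g s = g t.
Proof.
move=> gd; wlog st : s t / s <= t => [H s0 t0|s0 t0].
  by have [/H->//|/ltW/H->] := leP s t.
have [||r _] := @MVT_segment R g (fun=> 0) s t st.
- move=> r; rewrite in_itv /= => /andP[sr _]; exact: gd (lt_trans s0 sr).
- apply: continuous_in_subspaceT => r; rewrite inE /= in_itv /= => /andP[sr _].
  apply/differentiable_continuous/derivable1_diffP.
  by case: (gd r (lt_le_trans s0 sr)).
by rewrite mul0r => /eqP; rewrite subr_eq0 => /eqP ->.
Qed.

(** The equation says that t^a f' is a constant c.  If a >= 1, then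
    |f (2 t) - f t| >= |c| / 2 for small t by the mean value theorem, and f could
    not tend to 0 unless c = 0.  If a < 1, then f - c / (1 - a) t^(1 - a) is
    constant, with limit 0 at 0, and a negative c would make f unbounded below. *)
Lemma euler_ode (a : R) (f f1 f2 : R -> R) :
  (forall t : R, 0 < t -> is_derive t 1 f (f1 t)) ->
  (forall t : R, 0 < t -> is_derive t 1 f1 (f2 t)) ->
  (forall t : R, 0 < t -> f2 t + a / t * f1 t = 0) ->
  (forall e : R, 0 < e -> exists2 r : R, 0 < r &
     forall t : R, 0 < t < r -> `|f t| <= e) ->
  (exists C : R, forall t : R, 0 < t -> - C < f t) ->
  exists Cs : R, 0 <= Cs /\ forall t : R, 0 < t -> f t = Cs * t `^ (1 - a).
Proof.
move=> fd f1d ode f0 [C fC].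
have f1E (t : R) : 0 < t -> f1 t = f1 1 * (t `^ a)^-1.
  move=> t0; have ta : t `^ a != 0 by rewrite gt_eqF// powR_gt0.
  suff H : t `^ a * f1 t = 1 `^ a * f1 1.
    by move: H; rewrite powR1 mul1r => <-; rewrite mulrAC mulfV// mul1r.
  apply: (@derive0_constant_pos (fun t => t `^ a * f1 t)) => // r r0.
  apply: is_derive_eq (is_derive_mulf (is_derive1_powR a r0) (f1d r r0)) _.
  have -> : f2 r = - (a / r * f1 r) by apply/eqP; rewrite -addr_eq0 ode.
  rewrite powRB; last by rewrite (@gt_eqF _ _ r) ?implybT.
  rewrite powRr1; last exact: ltW.
  by field; rewrite gt_eqF.
have [a1|a1] := ltP a 1; last first.
  have c0 : f1 1 = 0.
    apply/eqP; rewrite -normr_le0 leNgt; apply/negP => c0.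
    have [r r0 Hr] := f0 (`|f1 1| / 8) ltac:(by rewrite divr_gt0).
    pose t := Num.min r 1 / 4.
    have t0 : 0 < t by rewrite divr_gt0// lt_min r0 ltr01.
    have [tr t1] : 2 * t < r /\ 2 * t < 1.
      have : Num.min r 1 <= r by rewrite ge_min lexx.
      have : Num.min r 1 <= 1 by rewrite ge_min lexx orbT.
      by move: t0; rewrite /t => ? ? ?; split; lra.
    have [|||s] := @MVT R f f1 t (2 * t).
    - by lra.
    - move=> s; rewrite in_itv /= => /andP[ts _]; exact: fd (lt_trans t0 ts).
    - apply: continuous_in_subspaceT => s; rewrite inE /= in_itv /= => /andP[ts _].
      apply/differentiable_continuous/derivable1_diffP.
      by case: (fd s (lt_le_trans t0 ts)).
    rewrite in_itv /= => /andP[ts st] E.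
    have s0 : 0 < s by exact: lt_trans ts.
    have sa : (2 * t)^-1 <= (s `^ a)^-1.
      rewrite lef_pV2 ?posrE ?powR_gt0//; last lra.
      by rewrite (le_trans (ge1r_powR _ a1)) ?s0 ?ltW//=; lra.
    have : `|f1 1| / 2 <= `|f (2 * t) - f t|.
      rewrite E (f1E s)// !normrM (gtr0_norm (_ : 0 < (s `^ a)^-1)); last first.
        by rewrite invr_gt0 powR_gt0.
      rewrite (gtr0_norm (_ : 0 < 2 * t - t)); last lra.
      rewrite -mulrA ler_wpM2l//.
      have -> : 2^-1 = (2 * t)^-1 * (2 * t - t) by field; rewrite gt_eqF.
      by rewrite ler_wpM2r//; lra.
    have := Hr t ltac:(apply/andP; split; lra).
    have := Hr (2 * t) ltac:(apply/andP; split; lra).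
    have := ler_normB (f (2 * t)) (f t).
    by move: c0; lra.
  have fcst (s t : R) : 0 < s -> 0 < t -> f s = f t.
    apply: derive0_constant_pos => r r0.
    by have := fd r r0; rewrite (f1E r)// c0 mul0r.
  exists 0; split=> // t t0; rewrite mul0r; apply/eqP; rewrite -normr_le0.
  apply/ler_addgt0Pr => e e0; rewrite add0r.
  have [r r0 Hr] := f0 e e0.
  rewrite (fcst t (r / 2))// ?divr_gt0//; apply: Hr.
  by apply/andP; split; lra.
have b0 : 0 < 1 - a by lra.
pose Cs := f1 1 / (1 - a).
pose g t := f t - Cs * t `^ (1 - a).
have gcst (s t : R) : 0 < s -> 0 < t -> g s = g t.
  apply: derive0_constant_pos => r r0.
  have := is_derive_addf (fd r r0)
    (is_derive_mulf (is_derive_cst (- Cs) r 1) (is_derive1_powR (1 - a) r0)).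
  rewrite (_ : (fun s => _) = g); last first.
    by apply/funext => s'; rewrite /g /cst mulNr.
  move=> H; apply: is_derive_eq H _.
  have -> : 1 - a - 1 = - a by ring.
  by rewrite (f1E r)// powRN /cst /Cs; field; rewrite !gt_eqF// powR_gt0.
have g0 t : 0 < t -> g t = 0.
  move=> t0; apply/eqP; rewrite -normr_le0; apply/ler_addgt0Pr => e e0.
  rewrite add0r.
  have e20 : 0 < e / 2 by rewrite divr_gt0.
  have [r r0 Hr] := f0 _ e20.
  have : (fun t : R => Cs * t `^ (1 - a)) x @[x --> 0^'+] --> Cs * 0.
    by apply: cvgM; [exact: cvg_cst|exact: powR_cvg0].
  rewrite mulr0 => /cvgr0Pnorm_le/(_ _ e20) H.
  near (0 : R)^'+ => s.
  have s0 : 0 < s by [].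
  rewrite (gcst t s)// /g (le_trans (ler_normB _ _))//.
  have : `|f s| <= e / 2.
    by apply: Hr; rewrite s0 /=; near: s; exact: nbhs_right_lt.
  have : `|Cs * s `^ (1 - a)| <= e / 2 by near: s; exact: H.
  by lra.
have fE t : 0 < t -> f t = Cs * t `^ (1 - a).
  by move=> /g0/eqP; rewrite subr_eq0 => /eqP.
exists Cs; split=> //; rewrite leNgt; apply/negP => Cs0.
pose B := (`|C| + 1) / - Cs.
have B0 : 0 < B by rewrite divr_gt0// ?oppr_gt0// ltr_wpDl.
have t0 : 0 < B `^ (1 - a)^-1 by exact: powR_gt0.
have := fC _ t0; rewrite fE// -powRrM mulVf ?gt_eqF// powRr1 ?ltW//.
have -> : Cs * B = - (`|C| + 1) by rewrite /B; field; rewrite lt_eqF.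
by have := ler_norm C; lra.
Unshelve. all: by end_near. Qed.

End EulerODE.

(** * From the divergence form to the theorem *)

Section Liouville.
Context {R : realType} {n : nat}.
Implicit Types (x y z : 'rV[R]_n.+1).

Lemma class_C2_C2_on (u : 'rV[R]_n.+1 -> R) : class_C 2 (@half_space R n) u ->
  C2_on (@half_space R n) u (fun j => partial j u)
    (fun j l => partial l (partial j u)).
Proof.
move=> [_ uC] y yh.
have cont (f : 'rV[R]_n.+1 -> R) :
    {within @half_space R n, continuous f} -> {for y, continuous f}.
  rewrite continuous_open_subspace; last exact: open_half_space.
  by move=> H; apply: H; rewrite inE.
split=> [j|j|j l|j l].
- by split=> //; have [H _] := uC j; exact: H.
- by have [_ [+ _]] := uC j; exact: cont.
- by split=> //; have [_ [_ /(_ l)[H _]]] := uC j; exact: H.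
- by have [_ [_ /(_ l)[_ [+ _]]]] := uC j; exact: cont.
Qed.

Lemma divergence_form (a : R) (u : 'rV[R]_n.+1 -> R) x : half_space x ->
  C2_on (@half_space R n) u (fun j => partial j u)
    (fun j l => partial l (partial j u)) ->
  divergence (fun y => (last_coord y `^ a) *: grad u y) x =
  last_coord x `^ a * (\sum_j partial j (partial j u) x +
    a / last_coord x * partial ord_max u x).
Proof.
move=> xh uC; have [_ _ d2 _] := uC x xh.
rewrite /divergence.
have E (j : 'I_n.+1) : partial j (fun y => ((last_coord y `^ a) *: grad u y) 0 j) x =
    last_coord x `^ a * partial j (partial j u) x +
    (j == ord_max)%:R * (a * (last_coord x `^ a / last_coord x) * partial j u x).
  have -> : (fun y => ((last_coord y `^ a) *: grad u y) 0 j) =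
      (fun y => last_coord y `^ a) * partial j u.
    by apply/funext => y; rewrite !mxE.
  have pd : is_derive x (delta_mx 0 j) (fun y => last_coord y `^ a)
      (a * last_coord x `^ (a - 1) * (j == ord_max)%:R).
    have x0E : x = x + (0 : R) *: delta_mx 0 j by rewrite scale0r addr0.
    rewrite {1}x0E; apply/is_derive_line.
    have ld : is_derive (0 : R) 1 (fun s : R => last_coord (x + s *: delta_mx 0 j))
        (j == ord_max)%:R.
      rewrite (_ : (fun s : R => _) =
        (fun s : R => last_coord x + s * (j == ord_max)%:R)); last first.
        by apply/funext => s; rewrite /last_coord line_coord.
      exact: jet2_is_derive (jet2_affine _ _ _).
    have l0 : 0 < last_coord (x + (0 : R) *: delta_mx 0 j) by rewrite -x0E.
    have := @is_derive1_comp _ (fun t => t `^ a) _ 0 _ _ (is_derive1_powR a l0) ld.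
    by rewrite -x0E.
  rewrite {1}/partial; have [_ ->] := is_deriveM pd (d2 j j).
  rewrite powRB; last by rewrite (@gt_eqF _ _ (last_coord x)) ?implybT.
  rewrite powRr1 ?ltW// /GRing.scale /=.
  by ring.
rewrite (eq_bigr _ (fun j _ => E j)) big_split /= -mulr_sumr sum_delta.
by ring.
Qed.

Lemma C2_on_addc (A : set 'rV[R]_n.+1) (u : 'rV[R]_n.+1 -> R) d dd (c : R) :
  C2_on A u d dd -> C2_on A (fun x => u x + c) d dd.
Proof.
move=> uC y Ay; have [u1 d1 d2 dd1] := uC y Ay; split=> // j.
apply: is_derive_eq (is_deriveD (u1 j) (is_derive_cst c y (delta_mx 0 j))) _.
by rewrite addr0.
Qed.

(** For kexp > 0 the comparison is made with u + |C|, which is nonnegative and has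
    the constant boundary value |C|; for kexp <= 0, with u itself, because the
    Kelvin transform of a function with nonzero boundary values is too large at
    infinity. *)
Lemma horizontally_constant (a : R) (u : 'rV[R]_n.+1 -> R) d dd (C : R) y z :
  C2_on (@half_space R n) u d dd ->
  (forall x, half_space x ->
     \sum_j dd j j x + a / last_coord x * d ord_max x = 0) ->
  {within @closed_half_space R n, continuous u} ->
  (forall x, half_space x -> - C < u x) ->
  (forall x, half_space_boundary x -> u x = 0) ->
  half_space y -> half_space z -> last_coord y = last_coord z -> u y = u z.
Proof.
move=> uC2 ueq uC0 uC u0 yh zh yz.
have uC' x : closed_half_space x -> - `|C| <= u x.
  rewrite /closed_half_space /= le_eqVlt => /orP[/eqP/esym x0|xh].
    by rewrite u0// oppr_le0.
  by rewrite (le_trans _ (ltW (uC _ xh)))// lerN2 ler_norm.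
have [k0|k0] := ltP 0 (kexp (n := n) a); last first.
  have K x0 (m : R) : last_coord x0 = 0 -> 0 < m ->
      forall y, closed_half_space y -> m <= sqnorm (y - x0) ->
      kelvin a u x0 m y <= u y.
    by move=> ? ?; exact: (kelvin_le_neg uC2 ueq uC0 k0 u0 uC').
  by apply/le_anti/andP; split; apply: (kelvin_le_horizontal uC0 K).
pose U x := u x + `|C|.
have UC2 := C2_on_addc `|C| uC2.
have UC0 : {within @closed_half_space R n, continuous U}.
  by move=> x; apply: cvgD; [exact: uC0|exact: cvg_cst].
have Ub x : half_space_boundary x -> U x = `|C| by move=> xb; rewrite /U u0// add0r.
have U0 x : closed_half_space x -> 0 <= U x.
  by move=> xh; rewrite /U -lerBlDr sub0r uC'.
have K x0 (m : R) : last_coord x0 = 0 -> 0 < m ->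
    forall y, closed_half_space y -> m <= sqnorm (y - x0) ->
    kelvin a U x0 m y <= U y.
  by move=> ? ?; exact: (kelvin_le_pos UC2 ueq UC0 k0 (normr_ge0 C) Ub U0).
apply: (addIr `|C|); rewrite -!/(U _).
by apply/le_anti/andP; split; apply: (kelvin_le_horizontal UC0 K).
Qed.

Lemma constant_line_derive (f : 'rV[R]_n.+1 -> R) x v (l : R) :
  is_derive x v f l -> (forall t : R, f (x + t *: v) = f x) -> l = 0.
Proof.
move=> fd fc; have : is_derive (0 : R) 1 (fun t => f (x + t *: v)) l.
  by apply: (proj1 (@is_derive_line _ _ f x v 0 l)); rewrite scale0r addr0.
have -> : (fun t => f (x + t *: v)) = cst (f x) by exact/funext.
by move=> [_ <-]; exact: derive_cst.
Qed.

Lemma boundary_vertical_limit (u : 'rV[R]_n.+1 -> R) (e : R) :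
  {within @closed_half_space R n, continuous u} -> u 0 = 0 -> 0 < e ->
  exists2 r : R, 0 < r &
    forall t : R, 0 < t < r -> `|u (t *: delta_mx 0 ord_max)| <= e.
Proof.
move=> uC0 u0 e0.
have h0 : closed_half_space (0 : 'rV[R]_n.+1).
  by rewrite /closed_half_space /= /last_coord mxE.
have /subspace_continuousP/(_ 0 h0)/cvgrPdist_le/(_ e e0) := uC0.
move=> /nbhs_ballP[r /= r0 Hr]; exists r => // t /andP[t0 tr].
have : ball (0 : 'rV[R]_n.+1) r (t *: delta_mx 0 ord_max) ->
    closed_half_space (t *: delta_mx 0 ord_max : 'rV[R]_n.+1) ->
    `|u 0 - u (t *: delta_mx 0 ord_max)| <= e by exact: Hr.
rewrite u0 sub0r normrN; apply.
  split=> // i j; rewrite ord1 !mxE /ball /= sub0r normrN ?eqxx /=.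
  by case: (_ == _); rewrite ?mulr0 ?normr0// mulr1 gtr0_norm.
by rewrite /closed_half_space /= /last_coord !mxE ?eqxx ?mulr1 ltW.
Qed.

End Liouville.

Theorem theorem1p1 (R : realType) (n : nat) (hn : (2 <= n.+1)%N) (a : R)
    (u : 'rV[R]_n.+1 -> R)
    (hC2 : class_C 2 (@half_space R n) u)
    (hC0 : {within @closed_half_space R n, continuous u})
    (heq : forall x : 'rV[R]_n.+1, half_space x ->
       divergence (fun y => (last_coord y `^ a) *: grad u y) x = 0)
    (hbd : exists C : R, forall x : 'rV[R]_n.+1, half_space x -> - C < u x)
    (hu0 : forall x : 'rV[R]_n.+1, half_space_boundary x -> u x = 0) :
  exists Cstar : R, 0 <= Cstar /\
    forall x : 'rV[R]_n.+1, half_space x ->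
      u x = Cstar * (last_coord x) `^ (1 - a).
Proof.
have uC2 := class_C2_C2_on hC2.
have ueq x : half_space x -> \sum_j partial j (partial j u) x +
    a / last_coord x * partial ord_max u x = 0.
  move=> xh; have := heq x xh; rewrite divergence_form// => /eqP.
  by rewrite mulf_eq0 gt_eqF ?powR_gt0//= => /eqP.
have [C uC] := hbd.
have uconst y z : half_space y -> half_space z -> last_coord y = last_coord z ->
    u y = u z by exact: horizontally_constant uC2 ueq hC0 uC hu0.
have shift_last x (j : 'I_n.+1) (t : R) : j != ord_max ->
    last_coord (x + t *: delta_mx 0 j) = last_coord x.
  by move=> jN; rewrite /last_coord line_coord (negPf jN) mulr0 addr0.
have d0 x (j : 'I_n.+1) : half_space x -> j != ord_max -> partial j u x = 0.
  move=> xh jN; have [ud _ _ _] := uC2 x xh.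
  apply: constant_line_derive (ud j) _ => t.
  by apply: uconst; rewrite // /half_space /= shift_last.
have dd0 x (j : 'I_n.+1) : half_space x -> j != ord_max ->
    partial j (partial j u) x = 0.
  move=> xh jN; have [_ _ dd _] := uC2 x xh.
  apply: constant_line_derive (dd j j) _ => t.
  by rewrite !d0// /half_space /= shift_last.
pose vert (t : R) : 'rV[R]_n.+1 := t *: delta_mx 0 ord_max.
have vertN t : last_coord (vert t) = t by rewrite /last_coord !mxE !eqxx mulr1.
have verth (t : R) : 0 < t -> half_space (vert t) by rewrite /half_space /= vertN.
have vertd (f : 'rV[R]_n.+1 -> R) (t l : R) :
    is_derive (vert t) (delta_mx 0 ord_max) f l -> is_derive t 1 (f \o vert) l.
  have -> : f \o vert = (fun s => f (0 + s *: delta_mx 0 ord_max)).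
    by apply/funext => s; rewrite add0r.
  rewrite -[vert t]add0r.
  exact: (proj1 (@is_derive_line _ _ f 0 (delta_mx 0 ord_max) t l)).
have [|||||Cs [Cs0 uE]] := @euler_ode R a (u \o vert)
  (partial ord_max u \o vert) (partial ord_max (partial ord_max u) \o vert).
- by move=> t /verth/uC2[+ _ _ _] => /(_ ord_max); exact: vertd.
- by move=> t /verth/uC2[_ _ + _] => /(_ ord_max ord_max); exact: vertd.
- move=> t t0 /=; have := ueq (vert t) (verth t t0).
  rewrite (bigD1 ord_max)//= big1 ?addr0 ?vertN// => j jN.
  by rewrite dd0//; exact: verth.
- move=> e e0; apply: boundary_vertical_limit => //; apply: hu0.
  by rewrite /half_space_boundary /= /last_coord mxE.
- by exists C => t /verth/uC.
exists Cs; split=> // x xh.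
rewrite -uE// (uconst x (vert (last_coord x)))//; exact: verth.
Qed.
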